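(* For every dimension $n$ there exist constants $G_n>0$ and $\delta_n>0$, depending only on $n$, such that for every centrally symmetric convex body $S\subseteq\mathbb{R}^n$ and every $\delta\in[0,\delta_n]$, $$d(S_\delta,S)\le1+G_n\,\delta^{1/n}.$$
   Context: A convex body is a compact convex set with non-empty interior; it is centrally symmetric if $S=-S$. $|A|_n$ denotes $n$-dimensional volume. For a convex body $K\subseteq\mathbb{R}^n$ and $\delta\ge0$ the convex floating body is $K_\delta=\bigcap_{|K\cap H^-|_n\le\delta|K|_n}H^+$, the intersection being over all hyperplanes $H$ with closed half-spaces $H^+,H^-$ such that $|K\cap H^-|_n\le\delta|K|_n$. For centrally symmetric convex bodies $S_1,S_2$, $d(S_1,S_2)=\inf\{a\ge1:\frac1aS_1\subseteq S_2\subseteq aS_1\}$. *)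

(* Defs.v *)
From mathcomp Require Import all_boot all_order all_algebra.
From mathcomp Require Import all_classical all_reals all_analysis.
Set Implicit Arguments.
Unset Strict Implicit.
Unset Printing Implicit Defensive.
Import Order.TTheory GRing.Theory Num.Theory.
Import numFieldNormedType.Exports.
Local Open Scope classical_set_scope.
Local Open Scope ring_scope.

Definition box (R : realType) (n : nat) (a b : 'rV[R]_n) : set 'rV[R]_n :=
  [set x | forall i, a 0 i <= x 0 i <= b 0 i].

Definition box_volume (R : realType) (n : nat) (a b : 'rV[R]_n) : R :=
  \prod_(i < n) Num.max 0 (b 0 i - a 0 i).

(* n-dimensional Lebesgue outer measure, defined on all sets: the infimum of the
   total volume over countable covers by closed boxes. It agrees with Lebesgue
   measure on closed sets, the only ones whose volume is taken below. *)
Definition volume (R : realType) (n : nat) (A : set 'rV[R]_n) : \bar R :=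
  ereal_inf [set s | exists a b : nat -> 'rV[R]_n,
    A `<=` \bigcup_k box (a k) (b k) /\
    s = (\sum_(0 <= k <oo) (box_volume (a k) (b k))%:E)%E].

Definition convex_body (R : realType) (n : nat) (K : set 'rV[R]_n) : Prop :=
  [/\ compact K, convex_set (K : set (convex_lmodType 'rV[R]_n))
    & K° !=set0].

Definition centrally_symmetric (R : realType) (n : nat) (S : set 'rV[R]_n) :
  Prop := S = [set - x | x in S].

Definition dotp (R : realType) (n : nat) (u x : 'rV[R]_n) : R :=
  \sum_(i < n) u 0 i * x 0 i.

(* For u != 0, the pair (u, t) stands for the hyperplane dotp u x = t together
   with a choice of H^+ and H^-; (- u, - t) is the opposite choice. *)
Definition halfspace_pos (R : realType) (n : nat) (u : 'rV[R]_n) (t : R) :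
  set 'rV[R]_n := [set x | dotp u x <= t].

Definition halfspace_neg (R : realType) (n : nat) (u : 'rV[R]_n) (t : R) :
  set 'rV[R]_n := [set x | t <= dotp u x].

Definition floating_body (R : realType) (n : nat) (K : set 'rV[R]_n)
    (delta : R) : set 'rV[R]_n :=
  \bigcap_(h in [set h : 'rV[R]_n * R | h.1 != 0 /\
      (volume (K `&` halfspace_neg h.1 h.2) <= delta%:E * volume K)%E])
    halfspace_pos h.1 h.2.

Definition dilate (R : realType) (n : nat) (c : R) (S : set 'rV[R]_n) :
  set 'rV[R]_n := [set c *: x | x in S].

(* Extended-real infimum, so that the distance is +oo, and not the junk value
   inf set0 = 0, when no a is admissible. *)
Definition dist_bodies (R : realType) (n : nat) (S1 S2 : set 'rV[R]_n) :
  \bar R :=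
  ereal_inf [set a%:E | a in [set a : R |
    [/\ 1 <= a, dilate a^-1 S1 `<=` S2 & S2 `<=` dilate a S1]]].

(* Main.v *)
Require Import Defs.
From mathcomp Require Import all_boot all_order all_algebra.
From mathcomp Require Import all_classical all_reals all_analysis.
From mathcomp Require Import measurable_realfun ring lra.
Import Order.TTheory GRing.Theory Num.Theory.
Import numFieldNormedType.Exports.
Local Open Scope classical_set_scope.
Local Open Scope ring_scope.

Set Implicit Arguments.
Unset Strict Implicit.
Unset Printing Implicit Defensive.

(** The inclusion of the floating body in [S] holds because a point outside [S]
    can be cut off by a hyperplane that misses [S], and such a hyperplane
    removes volume 0 ([floating_body_subset]).

    For the other inclusion, let [x] be in [S], let [0 <= s < 1], and suppose
    that [s *: x] is cut off by a hyperplane with normal [u], so that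
    [t < dotp u (s *: x)] while the cap [S `&` halfspace_neg u t] has volume at
    most [delta] times that of [S].  By convexity [S] contains the homothetic
    copy [s *: x + (1 - s) *: S], and the points coming from
    the half [S `&` halfspace_neg u 0] have
    [dotp u]-value at least [dotp u (s *: x)], hence lie in the cap.  By
    symmetry this half carries at least half of the volume of [S].  Therefore
    the cap has at least [(1 - s) ^+ n / 2] times the volume of [S], and as that
    volume is positive and finite, [(1 - s) ^+ n <= 2 * delta].  So [s *: S] lies
    in the floating body as soon as [2 * delta < (1 - s) ^+ n]
    ([scale_mem_floating_body]), and [1 / s] slightly larger than
    [1 + 4 * delta `^ n^-1] achieves this for small [delta].

    The measure theory needed is monotonicity under homotheties and reflections,
    binary subadditivity, finiteness on compact sets, and positivity on sets
    with interior points.  Only the last one is not formal: a box must not be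
    coverable by countably many boxes of smaller total volume.  This follows by
    induction on the dimension ([fractional_cover_volume]). *)

(** * Boxes cannot be covered cheaply *)

Lemma lebesgue_measure_segment (R : realType) (a b : R) :
  lebesgue_measure (`[a, b]%classic : set R) = (Num.max 0 (b - a))%:E.
Proof.
rewrite lebesgue_measure_itv /= lte_fin.
case: ltP => ab; first by rewrite -EFinB max_r// subr_ge0 ltW.
by rewrite max_l// subr_le0.
Qed.

Definition row_behead (R : realType) n (a : 'rV[R]_n.+1) : 'rV[R]_n :=
  \row_i a 0 (lift ord0 i).

Definition row_cons (R : realType) n (x : R) (y : 'rV[R]_n) : 'rV[R]_n.+1 :=
  \row_i (if unlift ord0 i is Some j then y 0 j else x).

Lemma box_row_cons (R : realType) n (p q : 'rV[R]_n.+1) x y :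
  box p q (row_cons x y) <->
  `[p 0 ord0, q 0 ord0]%classic x /\ box (row_behead p) (row_behead q) y.
Proof.
split=> [h|[h1 h2] i].
  split=> [|i]; first by have := h ord0; rewrite mxE unlift_none /= in_itv.
  by have := h (lift ord0 i); rewrite !mxE liftK.
rewrite mxE; case: unliftP => [j|] ->; last by move: h1; rewrite /= in_itv.
by have := h2 j; rewrite !mxE.
Qed.

Lemma box_volume_recl (R : realType) n (a b : 'rV[R]_n.+1) :
  box_volume a b = Num.max 0 (b 0 ord0 - a 0 ord0) *
                   box_volume (row_behead a) (row_behead b).
Proof.
rewrite /box_volume big_ord_recl; congr (_ * _).
by apply: eq_bigr => i _; rewrite !mxE.
Qed.

Lemma box_volume_ge0 (R : realType) n (a b : 'rV[R]_n) : 0 <= box_volume a b.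
Proof. by apply: prodr_ge0 => i _; rewrite le_max lexx. Qed.

Lemma box_volume_diag (R : realType) n (hn : (0 < n)%N) (a : 'rV[R]_n) :
  box_volume a a = 0.
Proof. by rewrite /box_volume (bigD1 (Ordinal hn))//= subrr maxxx mul0r. Qed.

(** Covers are relaxed to weighted families that cover each point with total
    weight at least 1.  This makes the induction on the dimension close: over a
    point [x] of the first axis, the slices of the boxes whose first side misses
    [x] just get weight 0, and the induction hypothesis bounds the volume of the
    slice of [box a b] by the weighted sum of the slice volumes.  Integrating
    over the first side of [box a b], term by term, gives the claim. *)
Lemma fractional_cover_volume (R : realType) n (a b : 'rV[R]_n)
    (p q : nat -> 'rV[R]_n) (w : nat -> R) :
  (forall k, 0 <= w k) ->
  (forall y, box a b y ->
    (1 <= \sum_(0 <= k <oo) (w k * \1_(box (p k) (q k)) y)%:E)%E) ->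
  ((box_volume a b)%:E <=
     \sum_(0 <= k <oo) (w k * box_volume (p k) (q k))%:E)%E.
Proof.
elim: n => [|n IHn] in a b p q w * => w0 cov.
  (* In dimension 0 every box is the one point and has volume 1. *)
  have -> : box_volume a b = 1 by rewrite /box_volume big_ord0.
  have /cov : box a b a by case.
  move=> /le_trans; apply; apply: lee_nneseries => k; rewrite ?lee_fin.
    by move=> _ _; rewrite mulr_ge0.
  by move=> _; rewrite ler_wpM2l// /box_volume big_ord0 indicE; case: (_ \in _).
pose D : set R := `[a 0 ord0, b 0 ord0]%classic.
pose I k : set R := `[p k 0 ord0, q k 0 ord0]%classic.
pose v k := box_volume (row_behead (p k)) (row_behead (q k)).
have v0 k : 0 <= v k by exact: box_volume_ge0.
have mD : measurable D by exact: measurable_itv.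
have mI k : measurable (I k) by exact: measurable_itv.
have slice x : D x -> ((box_volume (row_behead a) (row_behead b))%:E <=
    \sum_(0 <= k <oo) (w k * v k)%:E * (\1_(I k) x)%:E)%E.
  move=> Dx.
  have -> : (\sum_(0 <= k <oo) (w k * v k)%:E * (\1_(I k) x)%:E =
    \sum_(0 <= k <oo) ((w k * \1_(I k) x) * v k)%:E)%E.
    by apply: eq_eseriesr => k _; rewrite -EFinM mulrAC.
  apply: IHn => [k|y yab]; first by rewrite mulr_ge0.
  have /cov/le_trans : box a b (row_cons x y) by apply/box_row_cons.
  apply; apply: lee_nneseries => [k _ _|k _].
    by rewrite lee_fin mulr_ge0.
  rewrite lee_fin -mulrA ler_wpM2l// !indicE -natrM mulnb ler_nat.
  case: (boolP (row_cons x y \in _)) => //; rewrite inE => /box_row_cons[h1 h2].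
  by rewrite !mem_set.
have f0 k x : (0 <= (w k * v k)%:E * (\1_(I k) x)%:E)%E.
  by rewrite -EFinM lee_fin !mulr_ge0.
have m1 k : measurable_fun D (fun x => (\1_(I k) x)%:E : \bar R).
  by apply/measurable_EFinP; exact: measurable_indic.
have mf k : measurable_fun D (fun x => (w k * v k)%:E * (\1_(I k) x)%:E)%E.
  exact: measurable_funeM.
rewrite box_volume_recl mulrC EFinM -lebesgue_measure_segment -/D.
rewrite -integral_cst//.
apply: (@le_trans _ _ (\int[lebesgue_measure]_(x in D)
    \sum_(0 <= k <oo) (w k * v k)%:E * (\1_(I k) x)%:E)%E).
  apply: ge0_le_integral => //.
  - by move=> x _; rewrite lee_fin box_volume_ge0.
  - by apply: (@ge0_emeasurable_sum _ _ _ D _ xpredT).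
rewrite integral_nneseries//; apply: lee_nneseries => [k _ _|k _].
  by apply: integral_ge0.
rewrite ge0_integralZl//; [|exact: m1|by rewrite lee_fin mulr_ge0].
rewrite integral_indic//; last exact: mI.
rewrite box_volume_recl -/(v k) (mulrC (Num.max _ _)) mulrA [leRHS]EFinM.
rewrite -lebesgue_measure_segment lee_wpmul2l ?lee_fin ?mulr_ge0//.
apply: le_measure => [||x [] //]; rewrite inE; last exact: mI.
by apply: measurableI; [exact: mI | exact: mD].
Qed.

Lemma box_volume_le_volume (R : realType) n (a b : 'rV[R]_n) A :
  box a b `<=` A -> ((box_volume a b)%:E <= volume A)%E.
Proof.
move=> abA; apply: le_ereal_inf_tmp => _ [p [q [Apq ->]]].
have -> : (\sum_(0 <= k <oo) (box_volume (p k) (q k))%:E =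
           \sum_(0 <= k <oo) (1 * box_volume (p k) (q k))%:E)%E.
  by apply: eq_eseriesr => k _; rewrite mul1r.
apply: (@fractional_cover_volume _ _ a b p q (fun=> 1)) => // y /abA/Apq[k _ yk].
have ind0 m : (0 <= (1 * \1_(box (p m) (q m)) y)%:E :> \bar R)%E.
  by rewrite lee_fin mul1r.
apply: le_trans (nneseries_lim_ge k.+1 (fun m _ _ => ind0 m)).
rewrite big_nat_recr//= [in X in (_ + X)%E]indicE mem_set// mul1r leeDr//.
exact: sume_ge0.
Qed.

(** * The outer measure [volume] *)

Lemma volume_ge0 (R : realType) n (A : set 'rV[R]_n) : (0 <= volume A)%E.
Proof.
apply: le_ereal_inf_tmp => _ [p [q [_ ->]]].
by apply: nneseries_ge0 => k _ _; rewrite lee_fin box_volume_ge0.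
Qed.

Lemma volume_le_box (R : realType) n (hn : (0 < n)%N) (a b : 'rV[R]_n) A :
  A `<=` box a b -> (volume A <= (box_volume a b)%:E)%E.
Proof.
move=> Aab; apply: ereal_inf_lbound.
(* The box itself, followed by boxes reduced to the point 0. *)
exists (fun k => if k == 0%N then a else 0).
exists (fun k => if k == 0%N then b else 0).
split=> [x /Aab xab|]; first by exists 0%N.
rewrite (nneseries_split 0 1)=> [|k _]; last by rewrite lee_fin box_volume_ge0.
rewrite add0n big_nat1 eseries0 ?adde0// => -[//|k] _ _.
by rewrite (box_volume_diag hn).
Qed.

(** Covers of [B] by boxes pull back to covers of [A].  Having the bound on
    volumes in this form treats reflections and homotheties alike. *)
Lemma volume_pullback (R : realType) n (f : 'rV[R]_n -> 'rV[R]_n) (r : R)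
    (A B : set 'rV[R]_n) :
  0 < r ->
  (forall a b, exists c d, f @^-1` box a b `<=` box c d /\
                           box_volume c d <= r * box_volume a b) ->
  A `<=` f @^-1` B -> (volume A <= r%:E * volume B)%E.
Proof.
move=> r0 fbox AB; rewrite -lee_pdivrMl//.
apply: le_ereal_inf_tmp => _ [a [b [Bab ->]]]; rewrite lee_pdivrMl//.
have /choice[cd cdP] : forall k, exists cd : 'rV[R]_n * 'rV[R]_n,
    f @^-1` box (a k) (b k) `<=` box cd.1 cd.2 /\
    box_volume cd.1 cd.2 <= r * box_volume (a k) (b k).
  by move=> k; have [c [d ?]] := fbox (a k) (b k); exists (c, d).
apply: (@le_trans _ _ (\sum_(0 <= k <oo) (box_volume (cd k).1 (cd k).2)%:E)%E).
  apply: ereal_inf_lbound; exists (fun k => (cd k).1), (fun k => (cd k).2).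
  split=> // x /AB/Bab[k _ xk]; exists k => //; exact: (cdP k).1.
rewrite -nneseriesZl; last by move=> k _; rewrite lee_fin box_volume_ge0.
apply: lee_nneseries => [k _ _|k _]; first by rewrite lee_fin box_volume_ge0.
by rewrite -EFinM lee_fin; exact: (cdP k).2.
Qed.

Lemma volume_opp (R : realType) n (A B : set 'rV[R]_n) :
  A `<=` -%R @^-1` B -> (volume A <= volume B)%E.
Proof.
rewrite -[leRHS]mul1e; apply: volume_pullback => // a b.
exists (- b), (- a); split=> [x h i|].
  by have := h i; rewrite !mxE lerNr andbC lerNl.
rewrite mul1r le_eqVlt; apply/orP; left; apply/eqP.
by apply: eq_bigr => i _; rewrite !mxE opprK addrC.
Qed.

Lemma volume_homothety (R : realType) n (x : 'rV[R]_n) (c : R)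
    (A B : set 'rV[R]_n) :
  0 < c -> A `<=` (fun y => x + c *: y) @^-1` B ->
  (volume A <= (c ^- n)%:E * volume B)%E.
Proof.
move=> c0; apply: volume_pullback; first by rewrite invr_gt0 exprn_gt0.
move=> a b; exists (c^-1 *: (a - x)), (c^-1 *: (b - x)); split=> [y h i|].
  have := h i; rewrite !mxE => /andP[h1 h2].
  by rewrite ler_pdivrMl// ler_pdivlMl// lerBlDl lerBrDl h1.
rewrite le_eqVlt; apply/orP; left; apply/eqP.
have -> : c ^- n = \prod_(i < n) c^-1 by rewrite prodr_const card_ord exprVn.
rewrite -big_split /=.
apply: eq_bigr => i _; rewrite !mxE -mulrBr.
have -> : b 0 i - x 0 i - (a 0 i - x 0 i) = b 0 i - a 0 i.
  by rewrite opprB addrA subrK.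
by rewrite maxr_pMr ?mulr0// invr_ge0 ltW.
Qed.

Lemma volume_adherent (R : realType) n (A : set 'rV[R]_n) (e : R) :
  0 < e -> volume A \is a fin_num ->
  exists a b : nat -> 'rV[R]_n, A `<=` \bigcup_k box (a k) (b k) /\
    (\sum_(0 <= k <oo) (box_volume (a k) (b k))%:E <= volume A + e%:E)%E.
Proof.
move=> e0 fA; have [_ [a [b [Aab ->]]] /ltW le] := lb_ereal_inf_adherent e0 fA.
by exists a, b.
Qed.

(** A cover of [B] and a cover of [C] are interleaved into one sequence. *)
Lemma volumeU (R : realType) n (A B C : set 'rV[R]_n) :
  A `<=` B `|` C -> (volume A <= volume B + volume C)%E.
Proof.
move=> ABC.
have [->|By] := eqVneq (volume B) +oo%E.
  by rewrite addye ?leey// gt_eqF// (lt_le_trans _ (volume_ge0 C)).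
have [->|Cy] := eqVneq (volume C) +oo%E.
  by rewrite addey ?leey// gt_eqF// (lt_le_trans _ (volume_ge0 B)).
apply/lee_addgt0Pr => e e0; have e20 : 0 < e / 2 by rewrite divr_gt0.
have finB : volume B \is a fin_num by rewrite ge0_fin_numE ?volume_ge0// ltey.
have finC : volume C \is a fin_num by rewrite ge0_fin_numE ?volume_ge0// ltey.
have [a [b [Bab leB]]] := volume_adherent e20 finB.
have [c [d [Ccd leC]]] := volume_adherent e20 finC.
rewrite [e]splitr EFinD addeACA; apply: le_trans (leeD leB leC).
pose p k := if odd k then c k./2 else a k./2.
pose q k := if odd k then d k./2 else b k./2.
apply: (@le_trans _ _ (\sum_(0 <= k <oo) (box_volume (p k) (q k))%:E)%E).
  apply: ereal_inf_lbound; exists p, q; split=> // x /ABC[/Bab|/Ccd] [k _ xk].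
    by exists k.*2 => //; rewrite /p /q odd_double doubleK.
  by exists k.*2.+1 => //; rewrite /p /q /= odd_double uphalf_double.
rewrite -nneseriesD; try by move=> k _ _; rewrite lee_fin box_volume_ge0.
apply: lime_le.
  by apply: is_cvg_nneseries => k _ _; rewrite lee_fin box_volume_ge0.
apply: nearW => N.
have dbl : (\sum_(0 <= k < N.*2) (box_volume (p k) (q k))%:E =
   \sum_(0 <= k < N) ((box_volume (a k) (b k))%:E + (box_volume (c k) (d k))%:E))%E.
  elim: N => [|N IHN]; first by rewrite !big_geq.
  rewrite doubleS !big_nat_recr//= IHN /p /q /= odd_double /= doubleK uphalf_double.
  by rewrite addeA.
have ge0 k : (0 <= (box_volume (a k) (b k))%:E + (box_volume (c k) (d k))%:E)%E.
  by rewrite -EFinD lee_fin addr_ge0 ?box_volume_ge0.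
apply: le_trans (nneseries_lim_ge N (fun k _ _ => ge0 k)).
rewrite -dbl -addnn; rewrite [leRHS](@big_cat_nat _ _ _ N)/= ?leq_addr// leeDl//.
by apply: sume_ge0 => k _; rewrite lee_fin box_volume_ge0.
Qed.


(** * Separating a point from a compact convex set *)

Lemma dotpC (R : realType) n (u v : 'rV[R]_n) : dotp u v = dotp v u.
Proof. by apply: eq_bigr => i _; rewrite mulrC. Qed.

Lemma dotpDr (R : realType) n (u v w : 'rV[R]_n) :
  dotp u (v + w) = dotp u v + dotp u w.
Proof. by rewrite -big_split /=; apply: eq_bigr => i _; rewrite mxE mulrDr. Qed.

Lemma dotpZr (R : realType) n (c : R) (u v : 'rV[R]_n) :
  dotp u (c *: v) = c * dotp u v.
Proof.
by rewrite /dotp big_distrr /=; apply: eq_bigr => i _; rewrite mxE mulrCA.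
Qed.

Lemma dotpNr (R : realType) n (u v : 'rV[R]_n) : dotp u (- v) = - dotp u v.
Proof. by rewrite -scaleN1r dotpZr mulN1r. Qed.

Lemma dotpBr (R : realType) n (u v w : 'rV[R]_n) :
  dotp u (v - w) = dotp u v - dotp u w.
Proof. by rewrite dotpDr dotpNr. Qed.

Lemma dotp_sqrB (R : realType) n (u v : 'rV[R]_n) (l : R) :
  dotp (u - l *: v) (u - l *: v) =
  dotp u u - 2 * l * dotp u v + l ^+ 2 * dotp v v.
Proof.
rewrite dotpBr dotpZr [dotp _ u]dotpC [dotp _ v]dotpC !dotpBr !dotpZr.
by rewrite [dotp v u]dotpC; ring.
Qed.

Lemma dotp_gt0 (R : realType) n (u : 'rV[R]_n) : u != 0 -> 0 < dotp u u.
Proof.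
move=> u0; rewrite lt_def sumr_ge0 ?andbT; last by move=> i _; rewrite -expr2 sqr_ge0.
apply: contra u0; rewrite psumr_eq0 => [/allP u0|i _]; last by rewrite -expr2 sqr_ge0.
apply/eqP/rowP => i; rewrite mxE.
by have := u0 i (mem_index_enum _); rewrite /= mulf_eq0 orbb => /eqP.
Qed.

Lemma continuous_dist2 (R : realType) n (x : 'rV[R]_n) :
  continuous (fun y : 'rV[R]_n => dotp (x - y) (x - y)).
Proof.
move=> y; rewrite /dotp; apply: cvg_big => [||i _].
- exact: add_continuous.
- exact: (@nbhs_filter 'rV[R]_n y).
have h : (fun z : 'rV[R]_n => (x - z) 0 i) z @[z --> y] --> (x - y) 0 i.
  have -> : (fun z : 'rV[R]_n => (x - z) 0 i) = (fun z => x 0 i - z 0 i).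
    by apply/funext => z; rewrite !mxE.
  have -> : (x - y) 0 i = x 0 i - y 0 i by rewrite !mxE.
  apply: (@cvgB _ _ _ (nbhs y)); [exact: cvg_cst | exact: coord_continuous].
by apply: (@cvgM _ _ (nbhs y)).
Qed.

Lemma convex_setP (R : realType) n (S : set 'rV[R]_n) (x y : 'rV[R]_n) (l : R) :
  convex_set (S : set (convex_lmodType 'rV[R]_n)) -> S x -> S y ->
  0 <= l <= 1 -> S (l *: x + (1 - l) *: y).
Proof.
move=> cS Sx Sy l01.
have [l0 l1] := andP l01.
by have := cS x y (Itv01 l0 l1); rewrite !inE; apply.
Qed.

(** The normal is [x - c], where [c] is the point of [S] nearest to [x]: if some
    [y] in [S] had a larger scalar product with it than [c] has, then moving
    slightly from [c] towards [y] inside [S] would come closer to [x]. *)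
Lemma strict_separation (R : realType) n (S : set 'rV[R]_n) (x : 'rV[R]_n) :
  compact S -> convex_set (S : set (convex_lmodType 'rV[R]_n)) ->
  S !=set0 -> ~ S x ->
  exists u t, [/\ u != 0, t < dotp u x & forall y, S y -> dotp u y < t].
Proof.
move=> cS convS S0 Sx.
have [c cinS cmin] := EVT_min_rV S0 cS (continuous_subspaceT (@continuous_dist2 R n x)).
have Sc : S c by rewrite inE in cinS.
have u0 : x - c != 0.
  by apply: contra_notN Sx; rewrite subr_eq0 => /eqP ->.
move: cmin; set u := x - c => cmin.
have uu := dotp_gt0 u0.
have le y : S y -> dotp u y <= dotp u c.
  move=> Sy; rewrite leNgt; apply/negP => d0.
  set v := y - c; set d := dotp u v.
  have {}d0 : 0 < d by rewrite /d dotpBr subr_gt0.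
  have small (l : R) : 0 < l <= 1 -> 2 * d <= l * dotp v v.
    move=> /andP[l0 l1].
    have : S (l *: y + (1 - l) *: c) by apply: convex_setP => //; rewrite (ltW l0).
    rewrite -in_setE => /cmin.
    have -> : x - (l *: y + (1 - l) *: c) = u - l *: v.
      by rewrite /u /v; apply/rowP => i; rewrite !mxE; ring.
    rewrite dotp_sqrB -/d => h.
    by rewrite -(ler_pM2l l0) -/v; nra.
  (* The quadratic [- 2 * l * d + l ^+ 2 * dotp v v] is negative at
     [l = d / dotp v v], and at [l = 1] when this value exceeds 1. *)
  have [vd|dv] := leP (dotp v v) d.
    by have := small 1; rewrite ltr01 lexx => /(_ isT); lra.
  have v0 := lt_trans d0 dv.
  have := small (d / dotp v v).
  rewrite divr_gt0// ler_pdivrMr// mul1r (ltW dv) => /(_ isT).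
  by rewrite divfK ?gt_eqF//; lra.
(* The hyperplane halfway between [c] and [x]. *)
exists u, (dotp u c + dotp u u / 2); split=> // [|y /le h]; last first.
  by rewrite (le_lt_trans h)// ltrDl divr_gt0.
have -> : dotp u x = dotp u c + dotp u u by rewrite -dotpDr addrC subrK.
by rewrite ltrD2l; lra.
Qed.

Lemma volume_set0 (R : realType) n (hn : (0 < n)%N) :
  volume (set0 : set 'rV[R]_n) = 0%E.
Proof.
apply/eqP; rewrite eq_le volume_ge0 andbT.
by rewrite -[0%E]/(0%:E) -(box_volume_diag hn 0); exact: volume_le_box.
Qed.

Lemma compact_volume_fin_num (R : realType) n (hn : (0 < n)%N)
    (K : set 'rV[R]_n) :
  compact K -> volume K \is a fin_num.
Proof.
move=> /compact_bounded[M [_ KM]]; rewrite ge0_fin_numE ?volume_ge0//.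
apply: le_lt_trans (ltry (box_volume (const_mx (- (M + 1))) (const_mx (M + 1)))).
apply: volume_le_box => // x Kx i; rewrite !mxE -ler_norml.
have xM : `|x| <= M + 1 by apply: KM => //; rewrite ltrDl.
apply: le_trans xM; rewrite [leRHS]/Num.norm /= mx_normrE; apply/bigmax_geP; right => /=.
by exists (ord0, i).
Qed.

Lemma interior_volume_gt0 (R : realType) n (K : set 'rV[R]_n) :
  K° !=set0 -> (0 < volume K)%E.
Proof.
move=> [x /nbhs_ballP[e /= e0 xeK]].
pose h : 'rV[R]_n := const_mx (e / 2).
apply: (@lt_le_trans _ _ (box_volume (x - h) (x + h))%:E).
  rewrite lte_fin prodr_gt0// => i _; rewrite lt_max !mxE; apply/orP; right.
  by lra.
apply: box_volume_le_volume => y xy; apply: xeK; split=> // i j.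
have := xy j; rewrite !mxE [i]ord1 /ball /= ltr_norml => /andP[h1 h2].
by apply/andP; split; lra.
Qed.

(** * Floating bodies of centrally symmetric convex bodies *)

Lemma convex_body_nonempty (R : realType) n (S : set 'rV[R]_n) :
  convex_body S -> S !=set0.
Proof. by case=> _ _ [x /interior_subset Sx]; exists x. Qed.

Lemma centrally_symmetricN (R : realType) n (S : set 'rV[R]_n) x :
  centrally_symmetric S -> S x -> S (- x).
Proof. by move=> symS Sx; rewrite symS; exists x. Qed.

(** For [delta = 0] too: the hyperplane separating a point from [S] cuts off the
    empty set, whose volume 0 never exceeds [delta] times that of [S]. *)
Lemma floating_body_subset (R : realType) n (hn : (0 < n)%N)
    (S : set 'rV[R]_n) (delta : R) :
  convex_body S -> 0 <= delta -> floating_body S delta `<=` S.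
Proof.
move=> bS d0 x Sdx; apply: contrapT => Sx.
have [cS convS _] := bS.
have [u [t [u0 tx St]]] := strict_separation cS convS (convex_body_nonempty bS) Sx.
suff xt : dotp u x <= t by move: tx; rewrite ltNge xt.
apply: (Sdx (u, t)); split=> //; have -> : S `&` halfspace_neg u t = set0.
  by apply/seteqP; split=> // y [/St]; rewrite /halfspace_neg /= ltNge => /negP.
by rewrite volume_set0// mule_ge0 ?lee_fin ?volume_ge0.
Qed.

(** The two halves of [S] cover it and are exchanged by [-%R]. *)
Lemma volume_halfspace_sym (R : realType) n (S : set 'rV[R]_n) u :
  centrally_symmetric S ->
  (volume S <= volume (S `&` halfspace_neg u 0) +
               volume (S `&` halfspace_neg u 0))%E.
Proof.
move=> symS; apply: (@le_trans _ _ (volume (S `&` halfspace_neg u 0) +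
                                    volume (S `&` halfspace_pos u 0))%E).
  apply: volumeU => y Sy; case: (leP 0 (dotp u y)) => uy; [left|right] => //.
  by split=> //; exact: ltW.
rewrite leeD2l//; apply: volume_opp => y [Sy uy]; split.
  exact: centrally_symmetricN.
by rewrite /halfspace_neg /= dotpNr oppr_ge0.
Qed.

(** The heart of the matter: the homothety [y |-> s *: x + (1 - s) *: y] sends
    [S `&` halfspace_neg u 0] into any cap of [S] that contains [s *: x], so such
    a cap has at least [(1 - s) ^+ n / 2] times the volume of [S]. *)
Lemma scale_mem_floating_body (R : realType) n (hn : (0 < n)%N)
    (S : set 'rV[R]_n) (delta s : R) x :
  convex_body S -> centrally_symmetric S -> 0 <= delta -> 0 <= s < 1 ->
  2 * delta < (1 - s) ^+ n -> S x -> floating_body S delta (s *: x).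
Proof.
move=> [cS convS iS] symS d0 /andP[s0 s1] dn Sx [u t] [/= u0 vol].
rewrite /halfspace_pos /= leNgt; apply/negP => tx.
have c0 : 0 < 1 - s by rewrite subr_gt0.
have half : (volume (S `&` halfspace_neg u 0) <=
    ((1 - s) ^- n)%:E * volume (S `&` halfspace_neg u t))%E.
  apply: (volume_homothety c0 (x := s *: x)) => y [Sy uy]; split.
    by apply: convex_setP => //; rewrite s0 ltW.
  by rewrite /halfspace_neg /= dotpDr (le_trans (ltW tx))// lerDl dotpZr mulr_ge0// ltW.
have cn0 : 0 < (1 - s) ^+ n by rewrite exprn_gt0.
have finS := compact_volume_fin_num hn cS.
have := interior_volume_gt0 iS.
have cV0 : (0 <= ((1 - s) ^- n)%:E :> \bar R)%E by rewrite lee_fin invr_ge0 ltW.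
have {vol}half := le_trans half (lee_wpmul2l cV0 vol).
have := le_trans (volume_halfspace_sym u symS) (leeD half half).
move: finS => /fineK <-; move: (fine _) => v.
rewrite -!EFinM -EFinD lee_fin lte_fin => h v0; move: h; apply/negP; rewrite -ltNge.
rewrite -mulr2n -mulr_natl mulrCA ltr_pdivrMl// mulrA.
by rewrite ltr_pM2r.
Qed.

Lemma convex_symmetric_scale (R : realType) n (S : set 'rV[R]_n) (s : R) x :
  convex_set (S : set (convex_lmodType 'rV[R]_n)) -> centrally_symmetric S ->
  0 <= s <= 1 -> S x -> S (s *: x).
Proof.
move=> convS symS /andP[s0 s1] Sx.
(* [s *: x] lies on the segment from [- x] to [x]. *)
have -> : s *: x = ((1 + s) / 2) *: x + (1 - (1 + s) / 2) *: (- x).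
  by apply/rowP => i; rewrite !mxE; lra.
apply: convex_setP => //; first exact: centrally_symmetricN.
by apply/andP; split; lra.
Qed.

Theorem proposition6p1 (R : realType) (n : nat) (hn : (0 < n)%N) :
  exists G delta0 : R, [/\ 0 < G, 0 < delta0 &
    forall S : set 'rV[R]_n, convex_body S -> centrally_symmetric S ->
    forall delta : R, 0 <= delta <= delta0 ->
      (dist_bodies (floating_body S delta) S
        <= (1 + G * delta `^ (n%:R^-1))%:E)%E].
Proof.
(* With [r = delta `^ n^-1], a dilation factor [a <= 2] gives
   [1 - a^-1 >= (a - 1) / 2], which exceeds [2 * r] once [a > 1 + 4 * r], and
   [(2 * r) ^+ n >= 2 * delta].  The bound on [delta] means [r <= 1/8]. *)
exists 4, (8^-1 ^+ n); split=> //.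
move=> S bS symS delta /andP[d0 d8]; have [cS convS iS] := bS.
set r := delta `^ _.
have r0 : 0 <= r by exact: powR_ge0.
have rn : r ^+ n = delta.
  by rewrite -powR_mulrn// -powRrM mulVf ?powRr1// pnatr_eq0 -lt0n.
have r8 : r <= 8^-1 by rewrite -(ler_pXn2r hn) ?nnegrE// rn.
apply/lee_addgt0Pr => e e0.
(* The margin [Num.min e 2^-1] makes [2 * r < 1 - a^-1] strict even for
   [delta = 0]; being at most [1/2], it keeps [a <= 2] since [4 * r <= 1/2]. *)
pose a := 1 + 4 * r + Num.min e 2^-1.
have [me m2] : Num.min e 2^-1 <= e /\ Num.min e 2^-1 <= 2^-1 by rewrite !ge_min !lexx orbT.
have m0 : 0 < Num.min e 2^-1 by rewrite lt_min e0 invr_gt0 ltr0n.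
have a1 : 1 < a by rewrite /a; lra.
have a0 : 0 < a by lra.
have a2 : a <= 2 by rewrite /a; lra.
apply: ge_ereal_inf; exists a%:E; last by rewrite -EFinD lee_fin /a; lra.
exists a => //; split; first exact: ltW.
  move=> _ [x Sdx <-]; apply: convex_symmetric_scale => //.
    by rewrite invr_ge0 ltW//= invf_le1// ltW.
  exact: floating_body_subset Sdx.
move=> x Sx; exists (a^-1 *: x); last by rewrite scalerA divff ?scale1r ?gt_eqF.
apply: scale_mem_floating_body => //.
  by rewrite invr_ge0 ltW//= invf_lt1.
have lt2r : 2 * r < 1 - a^-1.
  rewrite -(ltr_pM2r a0) mulrBl mulVf ?gt_eqF// mul1r.
  apply: (@le_lt_trans _ _ (2 * r * 2)); first by rewrite ler_wpM2l// mulr_ge0.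
  by rewrite /a; lra.
apply: (@le_lt_trans _ _ ((2 * r) ^+ n)); last by rewrite ltr_pXn2r// nnegrE; lra.
rewrite exprMn rn ler_wpM2r//.
by case: (n) hn => // k _; rewrite exprS ler_peMr// exprn_ege1// ler1n.
Qed.
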